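(* For all integers $n$, $r$ and $k$ with $n\ge r-1\ge 0$, $$\sum_{j=r-1}^n\left\{{n+1\atop j+1}\right\}_r c_j^{(k)}=\sum_{\ell=1}^{r}(-1)^{r-\ell}\left[{r\atop \ell}\right]\sum_{i=0}^{n-r+\ell}\binom{n-r+\ell}{i}\frac{1}{(i+1)^k}.$$
   Context: For an integer $k$, the poly-Cauchy numbers (of the first kind) $c_n^{(k)}$ are defined by $\mathrm{Lif}_k(\log(1+x))=\sum_{n\ge0}c_n^{(k)}x^n/n!$, where $\mathrm{Lif}_k(z)=\sum_{m\ge0}\frac{z^m}{m!(m+1)^k}$. $\left[{n\atop m}\right]$ denotes the unsigned Stirling number of the first kind, defined by $x(x+1)\cdots(x+n-1)=\sum_{m}\left[{n\atop m}\right]x^m$. For $r\ge 0$, the $r$-Stirling number of the second kind $\left\{{n\atop m}\right\}_r$ is the number of ways to partition $\{1,\dots,n\}$ into $m$ nonempty disjoint blocks such that $1,\dots,r$ lie in distinct blocks; equivalently $\left\{{n\atop m}\right\}_r=0$ for $n<r$, $\left\{{r\atop m}\right\}_r=\delta_{m,r}$, and $\left\{{n\atop m}\right\}_r=m\left\{{n-1\atop m}\right\}_r+\left\{{n-1\atop m-1}\right\}_r$ for $n>r$. *)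

(* Defs.v *)
From mathcomp Require Import all_boot all_order all_algebra.

Set Implicit Arguments.
Unset Strict Implicit.
Unset Printing Implicit Defensive.

Import Order.TTheory GRing.Theory Num.Theory.
Local Open Scope ring_scope.

(* The formal power series \sum_n f_n x^n over Q is represented by its
   coefficient sequence f. *)
Definition fps := nat -> rat.

Definition fps_one : fps := fun n => (n == 0%N)%:R.

Definition fps_mul (f g : fps) : fps :=
  fun n => \sum_(i < n.+1) f i * g (n - i)%N.

Definition fps_exp (g : fps) (m : nat) : fps := iter m (fps_mul g) fps_one.

(* f(g(x)) = \sum_m f_m g(x)^m, meaningful when g has zero constant term: by
   [fps_exp_lt], the powers g^m with m > n then do not contribute to x^n. *)
Definition fps_comp (f g : fps) : fps :=
  fun n => \sum_(m < n.+1) f m * fps_exp g m n.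

Lemma fps_exp_lt (g : fps) (m n : nat) :
  g 0%N = 0 -> (n < m)%N -> fps_exp g m n = 0.
Proof.
move=> g0; elim: m n => [//|m IHm] n lt_nm.
rewrite /fps_exp iterS -/(fps_exp g m) /fps_mul big1 // => -[[|i] lt_in] _ /=.
  by rewrite g0 mul0r.
rewrite IHm ?mulr0 //; apply: leq_trans (_ : (n <= m)%N) => //.
by case: n lt_in {lt_nm} => // n _; rewrite subSS ltnS leq_subr.
Qed.

Definition fps_egf (a : nat -> rat) : fps := fun n => a n / n`!%:R.

(* log(1 + x) = \sum_(n >= 1) (-1)^(n-1) x^n / n; the constant term is 0
   because 0^-1 = 0 in [rat]. *)
Definition fps_log1p : fps := fun n => (-1) ^+ n.-1 / n%:R.

(* Here [^] is the power with an exponent in [int]. *)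
Definition Lif (k : int) : fps := fun m => (m`!%:R * m.+1%:R ^ k)^-1.

Definition poly_cauchy (k : int) (n : nat) : rat :=
  n`!%:R * fps_comp (Lif k) fps_log1p n.

Lemma poly_cauchy_egf (k : int) :
  fps_egf (poly_cauchy k) =1 fps_comp (Lif k) fps_log1p.
Proof.
move=> n; rewrite /fps_egf /poly_cauchy mulrC mulKf //.
by rewrite pnatr_eq0 -lt0n fact_gt0.
Qed.

Definition stirling1 (n m : nat) : nat :=
  ((\prod_(i < n) ('X + (i : nat)%:P) : {poly nat})`_m)%R.

(* The elements 1, ..., n are the ordinals 0, ..., n - 1, so that 1, ..., r are
   the i : 'I_n with i < r.  The conjunct r <= n makes the number 0 when n < r. *)
Definition r_stirling2 (r n m : nat) : nat :=
  #|[set P : {set {set 'I_n}} |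
      [&& (r <= n)%N, partition P [set: 'I_n], #|P| == m &
          [forall i : 'I_n, forall j : 'I_n,
             [&& (i < r)%N, (j < r)%N & i != j] ==>
               (pblock P i != pblock P j)]]]|.

(* Main.v *)
(* Let L be the linear functional on polynomials with L(X^m) = 1/(m+1)^k.  As
   n! [x^n] log(1+x)^m / m! is the coefficient of X^m in the falling factorial
   X^_n = X (X-1) ... (X-n+1), one has c_n^(k) = L(X^_n).  Counting the
   functions from N points to x points that are injective on the first r points
   by their kernels gives \sum_m {N, m}_r X^_m = X^_r X^(N-r); substituting X+1
   for X and dividing by X+1,
     \sum_j {n+1, j+1}_r X^_j = X^_(r-1) (X+1)^(n+1-r).
   Expanding (X+1)^_r = (X+1) X^_(r-1) in powers of X+1 by Stirling numbers of
   the first kind and applying L to both sides gives the theorem. *)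
Require Import Defs.
From mathcomp Require Import all_boot all_order all_algebra.

Set Implicit Arguments.
Unset Strict Implicit.
Unset Printing Implicit Defensive.

Import Order.TTheory GRing.Theory Num.Theory.

(** * Counting functions by their kernels *)

(** A partition is determined by the relation of lying in one block, so comparing partitions reduces
    to comparing relations. *)
Lemma preim_partition_eqP (T : finType) (X : eqType) (f : T -> X)
    (P : {set {set T}}) :
  partition P [set: T] ->
  reflect (forall x y, (f x == f y) = (y \in pblock P x))
          (preim_partition f [set: T] == P).
Proof.
move=> partP; apply: (iffP eqP) => [<- x y|fE].
  rewrite pblock_equivalence_partition ?inE //.
  by move=> u v w _ _ _; split=> // /eqP->.
rewrite -[RHS](equivalence_partition_pblock partP).
by apply: eq_imset => x; apply/setP => y; rewrite !inE fE.
Qed.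

(** Composing with the map from a point to its block identifies injections from the blocks of [P] to
    [X] with the functions of kernel [P]. *)
Lemma card_preim_partition (T X : finType) (P : {set {set T}}) :
  partition P [set: T] ->
  #|[set f : {ffun T -> X} | preim_partition f [set: T] == P]| = #|X| ^_ #|P|.
Proof.
move=> partP; have coverP := cover_partition partP.
have [_ tiP notP0] := and3P partP.
have blockP x : pblock P x \in P by rewrite pblock_mem // coverP.
pose block x : {B | B \in P} := exist _ (pblock P x) (blockP x).
have block_surj B : exists x, block x == B.
  case: B => B PB.
  have /set0Pn[x Bx] : B != set0 by apply: contraNneq notP0 => <-.
  by exists x; rewrite -val_eqE /= (def_pblock tiP PB Bx).
have block_eq x y : (block x == block y) = (y \in pblock P x).
  by rewrite -val_eqE /= eq_pblock ?coverP.
pose lift_fun (g : {ffun {B | B \in P} -> X}) := [ffun x => g (block x)].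
have lift_inj : injective lift_fun.
  move=> g h /ffunP eq_gh; apply/ffunP => B; have [x /eqP<-] := block_surj B.
  by have := eq_gh x; rewrite !ffunE.
rewrite -(card_sig (mem P)) -card_inj_ffuns -(card_imset _ lift_inj).
congr #|pred_of_set _|; apply/setP => f; rewrite inE.
apply/(preim_partition_eqP f partP)/imsetP => [fE|[g + ->] x y]; last first.
  by rewrite inE => /injectiveP injg; rewrite !ffunE (inj_eq injg) block_eq.
(* The injection is read off from [f] at a chosen point of each block; [gE] shows that the choice
   does not matter. *)
pose g := [ffun B => f (xchoose (block_surj B))].
have gE x : g (block x) = f x.
  by apply/eqP; rewrite ffunE fE -block_eq; exact: (xchooseP (block_surj (block x))).
exists g; last by apply/ffunP => x; rewrite ffunE gE.
rewrite inE; apply/injectiveP => B C.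
have [[x /eqP<-] [y /eqP<-]] := (block_surj B, block_surj C).
by rewrite !gE => /eqP; rewrite fE -block_eq => /eqP.
Qed.

Lemma card_ffun_inj_prefix (r s : nat) (X : finType) :
  #|[set f : {ffun 'I_(r + s) -> X} | injectiveb (fun i => f (lshift s i))]|
  = #|X| ^_ r * #|X| ^ s.
Proof.
pose split_fun (f : {ffun 'I_(r + s) -> X}) :=
  ([ffun i => f (lshift s i)], [ffun i => f (rshift r i)]).
have split_inj : injective split_fun.
  move=> f g [/ffunP eql /ffunP eqr]; apply/ffunP => i.
  by case: (split_ordP i) => j ->; [have := eql j | have := eqr j]; rewrite !ffunE.
rewrite -[r in X in X * _]card_ord -card_inj_ffuns -[s in X in _ * X]card_ord.
rewrite -card_ffun -cardsT -cardsX -(card_imset _ split_inj).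
congr #|pred_of_set _|; apply/setP => -[f1 f2]; rewrite !inE andbT.
apply/imsetP/injectiveP => [[f + [-> _]] i j|inj1].
  by rewrite inE !ffunE => /injectiveP/[apply].
exists [ffun i => match split i with inl j => f1 j | inr j => f2 j end].
  rewrite inE; apply/injectiveP => i j.
  by rewrite !ffunE -!/(unsplit (inl _)) !unsplitK => /inj1.
congr (_, _); apply/ffunP => i; rewrite !ffunE.
  by rewrite -/(unsplit (inl i)) unsplitK.
by rewrite -/(unsplit (inr i)) unsplitK.
Qed.

Lemma sum_r_stirling2_ffact (r s x : nat) :
  \sum_(m < (r + s).+1) r_stirling2 r (r + s) m * x ^_ m = x ^_ r * x ^ s.
Proof.
rewrite -[x in RHS]card_ord -card_ffun_inj_prefix -sum1dep_card.
pose sep (P : {set {set 'I_(r + s)}}) := [forall i : 'I_(r + s), forall j : 'I_(r + s),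
   [&& i < r, j < r & i != j] ==> (pblock P i != pblock P j)].
(* Sort the functions by kernel; injectivity on the first [r] points forces the kernel to separate
   them. *)
rewrite (partition_big (fun f : {ffun _ -> 'I_x} => preim_partition f setT)
  (fun P => partition P setT && sep P)) /=; last first.
  move=> f /injectiveP injf; rewrite preim_partitionP /=.
  apply/'forall_forallP => i j; apply/implyP => /and3P[lt_ir lt_jr].
  apply: contra; have partP := preim_partitionP f setT.
  have [_ tiP _] := and3P partP.
  rewrite eq_pblock ?(cover_partition partP) ?inE //.
  have /preim_partition_eqP-/(_ partP) <- := eqxx (preim_partition f setT).
  move/eqP; have -> : i = lshift s (Ordinal lt_ir) by apply: val_inj.
  by have -> : j = lshift s (Ordinal lt_jr) by [apply: val_inj]; move/injf->.
transitivity (\sum_(P : {set {set 'I_(r + s)}} | partition P setT && sep P) x ^_ #|P|).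
  (* Sort the partitions by number of blocks; [sizeP] ensures that [inord] does not alter this
     number. *)
  rewrite (partition_big (fun P : {set {set 'I_(r + s)}} => inord #|P| : 'I_(r + s).+1)
    predT) //=; apply: eq_bigr => m _.
  rewrite /r_stirling2 -sum1dep_card big_distrl /=.
  have sizeP P : partition P [set: 'I_(r + s)] -> #|P| < (r + s).+1.
    move=> partP; rewrite ltnS -[X in _ <= X]card_ord -cardsT.
    rewrite (card_partition partP) -sum1_card leq_sum // => B PB.
    rewrite card_gt0; apply: contraTneq PB => ->.
    by case/and3P: partP.
  apply: eq_big => [P|P].
    rewrite leq_addr /= andbAC -andbA -/(sep P).
    case: (boolP (partition P _)) => //= /sizeP ltP.
    by rewrite -val_eqE /= inordK 1?andbC.
  by case/and4P=> _ _ /eqP-> _; rewrite mul1n.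
(* Conversely, if [P] separates the first [r] points, every function with kernel [P] is injective on
   them. *)
apply: eq_bigr => P /andP[partP sepP].
rewrite -[x in LHS]card_ord -card_preim_partition // -sum1dep_card.
apply: eq_bigl => f; rewrite andbC; case: (preim_partition_eqP _) => //= fE.
apply/esym/injectiveP => i j /eqP; rewrite fE => Pij.
apply/eqP; have /'forall_forallP/(_ (lshift s i) (lshift s j)) := sepP.
rewrite /= !ltn_ord eq_lshift /= eq_pblock ?Pij ?(cover_partition partP) ?inE //.
  by case: eqP.
by case/and3P: partP.
Qed.

(** * The Euler-type derivation and powers of log(1+x) *)

Local Open Scope ring_scope.

(* (1 + x) d/dx *)
Definition fps_euler (f : fps) : fps := fun n => n.+1%:R * f n.+1 + n%:R * f n.

(** Leibniz rule: in each product of coefficients the weight [m] splits as [i + (m - i)], one part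
    for each factor. *)
Lemma fps_euler_mul (f g : fps) (n : nat) :
  fps_euler (fps_mul f g) n =
  fps_mul (fps_euler f) g n + fps_mul f (fps_euler g) n.
Proof.
have split_n (m : nat) : m%:R * fps_mul f g m =
    \sum_(i < m.+1) (i%:R * f i) * g (m - i)%N +
    \sum_(i < m.+1) f i * ((m - i)%:R * g (m - i)%N).
  rewrite /fps_mul mulr_sumr -big_split; apply: eq_bigr => i _ /=.
  have /subnKC/(congr1 (fun k => k%:R : rat)) <- : (i <= m)%N by rewrite -ltnS.
  by rewrite natrD mulrDl mulrA; congr (_ + _); rewrite mulrCA.
have lowerl : \sum_(i < n.+2) (i%:R * f i) * g (n.+1 - i)%N =
    \sum_(i < n.+1) (i.+1%:R * f i.+1) * g (n - i)%N.
  by rewrite big_ord_recl /= !mul0r add0r.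
have lowerr : \sum_(i < n.+2) f i * ((n.+1 - i)%:R * g (n.+1 - i)%N) =
    \sum_(i < n.+1) f i * ((n - i).+1%:R * g (n - i).+1).
  rewrite big_ord_recr /= subnn mul0r mulr0 addr0; apply: eq_bigr => i _.
  by rewrite subSn // -ltnS.
rewrite /fps_euler !split_n lowerl lowerr addrACA /fps_mul -!big_split /=.
by apply: eq_bigr => i _; rewrite mulrDl mulrDr.
Qed.

Lemma fps_mul1l (f : fps) : fps_mul fps_one f =1 f.
Proof.
move=> n; rewrite /fps_mul big_ord_recl /= subn0 mul1r big1 ?addr0 // => i _.
by rewrite mul0r.
Qed.

(** This is why d/dx is multiplied by 1 + x: no inverse of 1 + x is left. *)
Lemma fps_euler_log1p : fps_euler fps_log1p =1 fps_one.
Proof.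
case=> [|n]; first by rewrite /fps_euler /fps_log1p mul0r addr0.
rewrite /fps_euler /fps_log1p /= !(mulrC _%:R) !divfK ?pnatr_eq0 //.
by rewrite exprS mulN1r addNr.
Qed.

(** Power rule, where the inner derivative is 1. For [m = 0] the truncated [m.-1] is harmless, since
    the factor [m] vanishes. *)
Lemma fps_euler_log1p_exp (m n : nat) :
  fps_euler (fps_exp fps_log1p m) n = m%:R * fps_exp fps_log1p m.-1 n.
Proof.
elim: m n => [|m IHm] n.
  by rewrite /fps_euler mulr0 mul0r add0r; case: n => [|n]; rewrite /= ?mulr0 ?mul0r.
rewrite [LHS]fps_euler_mul -/(fps_exp fps_log1p m).
transitivity (fps_exp fps_log1p m n + m%:R * fps_exp fps_log1p m n); last first.
  by rewrite -addn1 natrD addrC mulrDl mul1r addn1.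
congr (_ + _).
  by rewrite -[RHS]fps_mul1l; apply: eq_bigr => i _; rewrite fps_euler_log1p.
rewrite /fps_mul; under eq_bigr => i _ do rewrite IHm mulrCA.
by rewrite -mulr_sumr; case: m {IHm} => [|m] //; rewrite !mul0r.
Qed.

(** * Falling factorial polynomials *)

Definition ffact_poly (R : nzRingType) (n : nat) : {poly R} :=
  \prod_(i < n) ('X - i%:R%:P).
Arguments ffact_poly {R} n.

Lemma ffact_polyS (R : nzRingType) (n : nat) :
  ffact_poly n.+1 = ffact_poly n * ('X - n%:R%:P) :> {poly R}.
Proof. exact: big_ord_recr. Qed.

Lemma size_ffact_poly (R : idomainType) (n : nat) :
  size (ffact_poly n : {poly R}) = n.+1.
Proof. by rewrite size_prod_XsubC /index_enum -enumT size_enum_ord. Qed.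

Lemma ffact_poly_nat (R : comNzRingType) (n x : nat) :
  (ffact_poly n).[x%:R] = (x ^_ n)%:R :> R.
Proof.
elim: n => [|n IHn]; first by rewrite /ffact_poly big_ord0 hornerC.
rewrite ffact_polyS hornerM IHn hornerXsubC ffactnSr natrM.
(* The subtraction in nat is truncated when [x < n], but then the preceding factor [x ^_ n] is
   already 0. *)
have [le_nx|lt_xn] := leqP n x; first by rewrite natrB.
by rewrite ffact_small ?mul0r.
Qed.

(** The factors become X+1, X, ..., X-n+1. The first one is what is later cancelled. *)
Lemma ffact_poly_shift (R : comNzRingType) (n : nat) :
  ffact_poly n.+1 \Po ('X + 1) = ('X + 1) * ffact_poly n :> {poly R}.
Proof.
elim: n => [|n IHn].
  by rewrite ffact_polyS /ffact_poly !big_ord0 mul1r mulr1 subr0 comp_polyX.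
rewrite ffact_polyS rmorphM /= IHn (ffact_polyS _ n) mulrA; congr (_ * _).
rewrite comp_polyB comp_polyX comp_polyC -addn1 natrD polyCD.
by rewrite opprD addrACA subrr addr0.
Qed.

Lemma coef_mulXsubC (R : nzRingType) (p : {poly R}) (c : R) (i : nat) :
  (p * ('X - c%:P))`_i = (if i is j.+1 then p`_j else 0) - p`_i * c.
Proof. by rewrite mulrBr coefB coefMX coefMC; case: i. Qed.

(** Falling and rising factorials obey the same recurrence up to sign. The exponent [n + m] has the
    parity of n - m and avoids truncation. *)
Lemma coef_ffact_poly (R : comNzRingType) (n m : nat) :
  (ffact_poly n)`_m = (-1) ^+ (n + m) * (stirling1 n m)%:R :> R.
Proof.
elim: n m => [|n IHn] m.
  rewrite /ffact_poly /stirling1 !big_ord0 !coef1.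
  by case: m => [|m]; rewrite ?mulr1 ?mulr0.
rewrite ffact_polyS coef_mulXsubC /stirling1 big_ord_recr /= mulrDr coefD.
rewrite coefMC coefMX natrD mulrDr IHn /stirling1.
congr (_ + _); last by rewrite natrM addSn exprS mulN1r mulNr mulrA.
by case: m => [|m] /=; rewrite ?mulr0 // IHn /stirling1 addSnnS !addnS !exprS mulrA mulrNN mulr1 mul1r.
Qed.

(** Both sides obey one recurrence in [n]: on the left it is the power rule read at x^n, on the
    right multiplication by X - n. *)
Lemma fps_exp_log1p_ffact (m n : nat) :
  n`!%:R * fps_exp fps_log1p m n = m`!%:R * (ffact_poly n)`_m.
Proof.
elim: n m => [|n IHn] m.
  rewrite /ffact_poly big_ord0 coef1; case: m => [//|m].
  by rewrite fps_exp_lt ?mulr0 //= /fps_log1p invr0 mulr0.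
have := fps_euler_log1p_exp m n; rewrite /fps_euler => /(canRL (addrK _)) E.
rewrite factS mulnC natrM -mulrA E mulrBr !(mulrCA n`!%:R) !IHn.
rewrite ffact_polyS coef_mulXsubC mulrBr; congr (_ - _).
  by case: m {E} => [|m]; rewrite ?mul0r ?mulr0 //= factS natrM mulrA.
by rewrite mulrC mulrA.
Qed.

(** * The linear functional L *)

(** L restricted to the coefficients below [N]. A common cutoff makes linearity one of finite sums;
    the value is that of L once [N] is at least [size p]. *)
Definition umbral (k : int) (N : nat) (p : {poly rat}) : rat :=
  \sum_(i < N) p`_i / i.+1%:R ^ k.

Lemma umbral_sum (k : int) (N : nat) (I : Type) (s : seq I) (a : I -> rat)
    (F : I -> {poly rat}) :
  umbral k N (\sum_(j <- s) a j *: F j) = \sum_(j <- s) a j * umbral k N (F j).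
Proof.
rewrite /umbral; under eq_bigr => i _ do rewrite coef_sum mulr_suml.
rewrite exchange_big /=; apply: eq_bigr => j _; rewrite mulr_sumr.
by apply: eq_bigr => i _; rewrite coefZ mulrA.
Qed.

Lemma umbral_widen (k : int) (M N : nat) (p : {poly rat}) :
  (size p <= M <= N)%N -> umbral k N p = umbral k M p.
Proof.
case/andP=> le_pM le_MN; rewrite /umbral (big_ord_widen _ (fun i => p`_i / i.+1%:R ^ k) le_MN).
rewrite [RHS]big_mkcond; apply: eq_bigr => i _; case: ltnP => // le_Mi.
by rewrite nth_default ?mul0r // (leq_trans le_pM).
Qed.

(** The [m!] in the denominator of [Lif] cancels the [m!] from the coefficients of log(1+x)^m. *)
Lemma umbral_ffact (k : int) (n N : nat) :
  (n < N)%N -> umbral k N (ffact_poly n) = poly_cauchy k n.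
Proof.
move=> lt_nN; rewrite (@umbral_widen _ n.+1) ?size_ffact_poly ?leqnn //.
rewrite /poly_cauchy /fps_comp mulr_sumr; apply: eq_bigr => m _.
rewrite /Lif mulrCA fps_exp_log1p_ffact invfM mulrC -mulrA mulrCA.
by rewrite mulKf // pnatr_eq0 -lt0n fact_gt0.
Qed.

Lemma umbral_X1_exp (k : int) (n N : nat) :
  (n < N)%N ->
  umbral k N (('X + 1) ^+ n) =
  \sum_(0 <= i < n.+1) 'C(n, i)%:R * (1 / i.+1%:R ^ k).
Proof.
have E (i : nat) : (('X + 1) ^+ n : {poly rat})`_i = 'C(n, i)%:R.
  rewrite addrC exprDn coef_sum.
  under eq_bigr => j _ do rewrite expr1n mul1r coefMn coefXn.
  have [lt_in|lt_ni] := ltnP i n.+1.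
    rewrite (bigD1 (Ordinal lt_in)) //= eqxx big1 ?addr0 // => j.
    by rewrite -val_eqE /= eq_sym => /negPf->; rewrite mul0rn.
  rewrite bin_small // big1 // => j _; case: eqP => [ij|]; last by rewrite mul0rn.
  by have := ltn_ord j; rewrite -ij ltnNge lt_ni.
move=> lt_nN; rewrite (@umbral_widen _ n.+1).
  by rewrite big_mkord; apply: eq_bigr => i _; rewrite E mul1r.
by rewrite lt_nN andbT; apply/leq_sizeP => i lt_ni; rewrite E bin_small.
Qed.

(** * Polynomial identities for the two kinds of Stirling numbers *)

(** Take [x = m] in the counting identity: the right side is 0, hence so is each term on the left,
    and the term of index [m] carries the nonzero factor [m!]. *)
Lemma r_stirling2_small (r s m : nat) :
  (m < r)%N -> r_stirling2 r (r + s) m = 0%N.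
Proof.
move=> lt_mr; have := sum_r_stirling2_ffact r s m.
rewrite ffact_small // mul0n => /eqP; rewrite sum_nat_eq0 => /forallP.
have lt_m : (m < (r + s).+1)%N by rewrite ltnS (leq_trans (ltnW lt_mr)) ?leq_addr.
by move/(_ (Ordinal lt_m)); rewrite /= ffactnn muln_eq0 (gtn_eqF (fact_gt0 m)) orbF => /eqP.
Qed.

(** The difference has more roots than its degree allows. *)
Lemma poly_eq_nat (R : numDomainType) (p q : {poly R}) :
  (forall x : nat, p.[x%:R] = q.[x%:R]) -> p = q.
Proof.
move=> eq_pq; apply/eqP; rewrite -subr_eq0; apply/eqP.
apply: (@roots_geq_poly_eq0 _ _ [seq i%:R | i <- iota 0 (size (p - q))]).
- by apply/allP => _ /mapP[x _ ->]; rewrite /root hornerD hornerN eq_pq subrr.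
- by rewrite map_inj_uniq ?iota_uniq // => x y /eqP; rewrite eqr_nat => /eqP.
- by rewrite size_map size_iota.
Qed.

Lemma sum_r_stirling2_ffact_poly (R : numDomainType) (r s : nat) :
  \sum_(m < (r + s).+1) (r_stirling2 r (r + s) m)%:R *: ffact_poly m =
  ffact_poly r * 'X^s :> {poly R}.
Proof.
apply: poly_eq_nat => x; rewrite horner_sum hornerM hornerXn ffact_poly_nat.
rewrite -natrX -natrM -sum_r_stirling2_ffact natr_sum.
by apply: eq_bigr => m _; rewrite hornerZ ffact_poly_nat natrM.
Qed.

Lemma X1_neq0 (R : nzRingType) : 'X + 1 != 0 :> {poly R}.
Proof. by rewrite -lead_coef_eq0 lead_coefXaddC oner_neq0. Qed.

Lemma sum_r_stirling2_ffact_poly_pred (R : numDomainType) (r s : nat) :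
  \sum_(r <= j < (r + s).+1)
    (r_stirling2 r.+1 (r + s).+1 j.+1)%:R *: ffact_poly j =
  ffact_poly r * ('X + 1) ^+ s :> {poly R}.
Proof.
apply: (mulfI (X1_neq0 R)).
rewrite mulrA -ffact_poly_shift -[X in _ * X ^+ s]comp_polyX -rmorphXn -rmorphM /=.
(* The term of index 0 vanishes and is split off, so that each remaining falling factorial yields a
   factor X+1. *)
rewrite -sum_r_stirling2_ffact_poly addSn raddf_sum /= big_ord_recl -addSn.
rewrite r_stirling2_small // scale0r comp_poly0 add0r mulr_sumr.
rewrite -(big_mkord predT (fun j => ((r_stirling2 r.+1 (r.+1 + s) j.+1)%:R *:
  ffact_poly j.+1) \Po ('X + 1))) /= [RHS](@big_cat_nat _ _ _ r) //=; last first.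
  by rewrite addSn leqW // leq_addr.
rewrite [X in _ = X + _]big1_seq ?add0r.
  by apply: eq_bigr => j _; rewrite comp_polyZ ffact_poly_shift scalerAr addSn.
move=> j; rewrite mem_index_iota => /andP[_ lt_jr].
by rewrite r_stirling2_small // scale0r comp_poly0.
Qed.

(** After multiplication by X+1 this is the monomial expansion of the falling factorial of order
    [r.+1], taken at X+1 and multiplied by [('X + 1) ^+ s]. *)
Lemma sum_stirling1_X1 (R : numDomainType) (r s : nat) :
  \sum_(1 <= l < r.+2)
    ((-1) ^+ (r.+1 - l) * (stirling1 r.+1 l)%:R) *: ('X + 1) ^+ (r + s + l - r.+1)
  = ffact_poly r * ('X + 1) ^+ s :> {poly R}.
Proof.
apply: (mulfI (X1_neq0 R)); rewrite mulrA -ffact_poly_shift comp_polyE.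
rewrite size_ffact_poly big_ord_recl.
(* The constant term is the value at 0; its vanishing leaves only powers divisible by X+1. *)
have -> : (ffact_poly r.+1 : {poly R})`_0 = 0.
  by rewrite -horner_coef0 -[0 in LHS]/(0%:R) ffact_poly_nat ffact_small.
rewrite scale0r add0r mulr_suml mulr_sumr big_add1 big_mkord.
apply: eq_bigr => l _; rewrite -scalerAr -scalerAl lift0 -!exprD -exprS.
have le_lr : (l <= r)%N by rewrite -ltnS.
rewrite coef_ffact_poly subSS; congr (_ * _ *: _ ^+ _).
  by rewrite -signr_odd -[RHS]signr_odd oddD oddB //= addbN addNb negbK.
by rewrite addnS subSS -addnA addKn addSn addnC.
Qed.

Theorem theorem2 (n r : nat) (k : int)
    (hr : (1 <= r)%N) (hnr : (r - 1 <= n)%N) :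
  \sum_(r - 1 <= j < n.+1) (r_stirling2 r n.+1 j.+1)%:R * poly_cauchy k j =
  \sum_(1 <= l < r.+1) (-1) ^+ (r - l) * (stirling1 r l)%:R *
    \sum_(0 <= i < (n + l - r).+1)
      'C(n + l - r, i)%:R * (1 / (i.+1%:R : rat) ^ k).
Proof.
case: r hr hnr => // r _; rewrite subSS subn0 => /subnKC <-.
move: (n - r)%N => s {n}.
(* Both sides are L of this polynomial of degree [r + s], expanded in falling factorials and in
   powers of X+1; no term of either expansion has a larger degree, so the cutoff loses nothing. *)
transitivity (umbral k (r + s).+1 (ffact_poly r * ('X + 1) ^+ s)).
  rewrite -sum_r_stirling2_ffact_poly_pred umbral_sum !big_seq.
  apply: eq_bigr => j; rewrite mem_index_iota => /andP[_ lt_j].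
  by rewrite umbral_ffact.
rewrite -sum_stirling1_X1 umbral_sum !big_seq.
apply: eq_bigr => l; rewrite mem_index_iota => /andP[_ lt_l].
by rewrite umbral_X1_exp // ltnS leq_subLR addnC leq_add2r -ltnS.
Qed.
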